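(* For any $n\ge2$, $\mathbf{m}$ with $m_i\ge 2$, and any $t\in\mathbb{N}$, $$\left\lfloor\frac{t}{n}\right\rfloor\frac{1}{q_{n,\mathbf{m}}}\left(1-\frac{\left(\left\lceil\frac{t}{n}\right\rceil\right)^2}{2}\frac{n}{q_{n,\mathbf{m}}}\right)\le\Pr\left[H\le t\right]\le\frac{t}{q_{n,\mathbf{m}}},$$ where $H=\inf\{\tau\ge 1:\mathbf{A}^\tau \text{ is a PNE of } G_{n,\mathbf{m}}\}$ is the hitting time of the set of PNE by the clockwork best-response dynamic.
   Context: A random game $G_{n,\mathbf{m}}$ has $n\ge 2$ players; player $i$ has action set $[m_i]=\{1,\dots,m_i\}$, $m_i\ge2$; $\mathcal{M}=\times_i[m_i]$. Payoffs $U_i(\mathbf{a})$ are drawn from a fixed atomless distribution on $\mathbb{R}$, independently across $i$ and $\mathbf{a}\in\mathcal{M}$. The best response $B_i(\mathbf{a}_{-i})=\arg\max_{x\in[m_i]}U_i(x,\mathbf{a}_{-i})$ is a.s. unique; a PNE is a profile $\mathbf{a}$ with $a_i=B_i(\mathbf{a}_{-i})$ for all $i$. The clockwork sequence is $s_{\texttt{c}}(t)=1+((t-1)\bmod n)$. The clockwork best-response dynamic: $\mathbf{A}^0$ uniform on $\mathcal{M}$ independent of payoffs; for $t\ge1$ with $i=s_{\texttt{c}}(t)$, $A^t_j=A^{t-1}_j$ ($j\ne i$) and $A^t_i=B_i(\mathbf{A}^{t-1}_{-i})$. $q_{n,\mathbf{m}}=\prod_i m_i/\max_i m_i$. $\inf\emptyset=\infty$.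 *)

(* Defs.v *)
From HB Require Import structures.
From mathcomp Require Import all_boot all_order all_algebra.
From mathcomp Require Import all_classical all_reals all_analysis.
Set Implicit Arguments. Unset Strict Implicit. Unset Printing Implicit Defensive.
Import Order.TTheory GRing.Theory Num.Theory.
Local Open Scope ring_scope.
Local Open Scope classical_set_scope.

(* Players are 'I_n (player i of the paper is the ordinal i-1);
   player i's actions are 'I_(m i) (action x of the paper is the ordinal x-1). *)
Definition profile (n : nat) (m : 'I_n -> nat) :=
  {dffun forall i : 'I_n, 'I_(m i)}.

Definition upd n (m : 'I_n -> nat) (a : profile m) (i : 'I_n) (x : 'I_(m i))
  : profile m := @finfun _ (fun j : 'I_n => 'I_(m j)) (@dfwith _ (fun j : 'I_n => 'I_(m j)) (fun k => a k) i x).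
Arguments upd {n m} a i x.

Section Game.
Variables (R : realType) (n : nat) (m : 'I_n -> nat).
Variable u : 'I_n -> profile m -> R.

(* best response B_i(a_{-i}) = argmax_x u i (x, a_{-i});
   (a.s. unique; ties, a null event, are broken by Order.arg_max) *)
Definition best_response (i : 'I_n) (a : profile m) : 'I_(m i) :=
  Order.arg_max (a i) xpredT (fun x : 'I_(m i) => u i (upd a i x)).

Definition is_PNE (a : profile m) : Prop :=
  forall i : 'I_n, a i = best_response i a.

(* clockwork dynamic: at step t+1 (t >= 0) player s_c(t+1) moves, i.e. the
   player with 0-based index t mod n *)
Definition clock_step (t : nat) (a : profile m) : profile m :=
  [ffun j : 'I_n => if (nat_of_ord j == t %% n)%N then best_response j a else a j].

Fixpoint clockwork (a0 : profile m) (t : nat) : profile m :=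
  match t with
  | 0 => a0
  | t'.+1 => clock_step t' (clockwork a0 t')
  end.
End Game.

Definition q_nm (R : realType) n (m : 'I_n -> nat) : R :=
  (\prod_(i < n) (m i)%:R) / (\max_(i < n) m i)%:R.

Definition random_game_setup d (T : measurableType d) (R : realType)
  (P : probability T R) n (m : 'I_n -> nat)
  (U : 'I_n -> profile m -> T -> R) (A0 : T -> profile m) : Prop :=
  [/\ (forall i a, measurable_fun setT (U i a)) /\
      (forall a, measurable (A0 @^-1` [set a])),
      (forall a, P (A0 @^-1` [set a]) = (#|{: profile m}|%:R^-1)%:E),
      (forall (B : 'I_n -> profile m -> set R) (S : set (profile m)),
          (forall i a, measurable (B i a)) ->
          P ([set w | S (A0 w)] `&` [set w | forall i a, B i a (U i a w)])
          = (P (A0 @^-1` S) *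
             \big[*%E/1%E]_(i < n) \big[*%E/1%E]_(a : profile m)
                P (U i a @^-1` B i a))%E),
      (forall i a j b (B : set R), measurable B ->
          P (U i a @^-1` B) = P (U j b @^-1` B)) &
      (forall i a (x : R), P (U i a @^-1` [set x]) = 0%E)].

(* the event {H <= t}, H = inf{tau >= 1 : A^tau is a PNE} *)
Definition hit_by d (T : measurableType d) (R : realType) n (m : 'I_n -> nat)
  (U : 'I_n -> profile m -> T -> R) (A0 : T -> profile m) (t : nat) : set T :=
  [set w | exists tau, (1 <= tau <= t)%N /\
     is_PNE (fun i a => U i a w) (clockwork (fun i a => U i a w) (A0 w) tau)].

(* Main.v *)
Require Import Defs.
From HB Require Import structures.
From mathcomp Require Import all_boot all_order all_algebra perm.
From mathcomp Require Import all_classical all_reals all_analysis.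
From mathcomp Require Import measurable_realfun zify ring.
Set Implicit Arguments.
Unset Strict Implicit.
Unset Printing Implicit Defensive.

(**
Almost surely there are no ties, so a game is a best-response table, and by
exchangeability of the payoffs the pair (initial profile, table) is uniform on
the finite set of states: probabilities are ratios of cardinalities.  Responses
that the play has not consulted yet may be resampled without altering the past.
Write M_j for the product of the m_i with i <> j; the minimum of the M_j is q.

Upper bound.  If A^T is the first PNE, the environments in A^T of the players
other than the last mover were never faced before, so H = T costs a factor M_j.

Lower bound.  Let T run over the first t/n moves of a player i0 with M_i0 = q.
If no mover up to T faced an environment twice, and no other player j faced its
environment in A^T except possibly at its last move, then A^T is a PNE with
conditional probability at least 1/q; these events are disjoint for different T.
Each forbidden coincidence forces a full round of fresh responses, hence has
probability at most 1/q, and the number of coincidences summed over T is at most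
n (t/n)^3 / 2.
*)

(** * Responses as tables, and resampling of unvisited entries *)

Section ResponseTables.

Variables (n : nat) (m : 'I_n -> nat).

(** Responses are indexed by full profiles, the player's own action included, which avoids a type of
    opponents' profiles; [consistent] restores the dependence on the environment alone. *)
Definition table := {dffun forall i : 'I_n, {ffun profile m -> 'I_(m i)}}.
Implicit Types (a c z : profile m) (b : table) (i j : 'I_n) (J : {set 'I_n}).

Definition same_env j a c := [forall l, (l != j) ==> (a l == c l)].

Lemma same_envP j a c :
  reflect (forall l, l != j -> a l = c l) (same_env j a c).
Proof.
apply: (iffP forallP) => [h l lj|h l]; first by apply/eqP/(implyP (h l)).
by apply/implyP => lj; rewrite h.
Qed.

Lemma same_env_refl j a : same_env j a a.
Proof. exact/same_envP. Qed.

Lemma same_env_sym j a c : same_env j a c = same_env j c a.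
Proof. by apply/same_envP/same_envP => h l lj; rewrite h. Qed.

Lemma same_env_trans j a c z :
  same_env j a c -> same_env j c z -> same_env j a z.
Proof. by move=> /same_envP h /same_envP k; apply/same_envP => l lj; rewrite h ?k. Qed.

Definition consistent b :=
  [forall i, forall a, forall c, same_env i a c ==> (b i a == b i c)].

Lemma consistentP b :
  reflect (forall i a c, same_env i a c -> b i a = b i c) (consistent b).
Proof.
apply: (iffP forallP) => [h i a c s|h i].
  by have /forallP/(_ c)/implyP/(_ s)/eqP := forallP (h i) a.
by apply/forallP => a; apply/forallP => c; apply/implyP => /h ->.
Qed.

Definition table_step b t a : profile m :=
  [ffun j : 'I_n => if (nat_of_ord j == t %% n)%N then b j a else a j].

Fixpoint play b a t : profile m :=
  if t is t'.+1 then table_step b t' (play b a t') else a.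

Definition table_PNE b a := [forall i, a i == b i a].

Lemma table_PNEP b a : reflect (forall i, a i = b i a) (table_PNE b a).
Proof. by apply: (iffP forallP) => h i; [apply/eqP|apply/eqP/h]. Qed.

Lemma playS b a t j :
  play b a t.+1 j = if (j == t %% n :> nat)%N then b j (play b a t) else play b a t j.
Proof. by rewrite /= ffunE. Qed.

Lemma play_still b a j s t : s <= t ->
  (forall r, s <= r < t -> r %% n != j) -> play b a t j = play b a s j.
Proof.
elim: t => [|t IH]; first by rewrite leqn0 => /eqP ->.
rewrite leq_eqVlt => /predU1P[->//|]; rewrite ltnS => st h.
rewrite playS eq_sym (negbTE (h _ _)) ?st ?ltnS ?leqnn // IH // => r /andP[sr rt].
by apply: h; rewrite sr ltnW.
Qed.

Lemma play_PNE b a s t : table_PNE b (play b a s) -> s <= t ->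
  play b a t = play b a s.
Proof.
move=> /table_PNEP h; elim: t => [|t IH]; first by rewrite leqn0 => /eqP ->.
rewrite leq_eqVlt => /predU1P[->//|]; rewrite ltnS => /IH e.
by apply/ffunP => j; rewrite playS e -h if_same.
Qed.

Lemma play_step_env b a t j : j = t %% n :> nat ->
  same_env j (play b a t) (play b a t.+1).
Proof.
by move=> e; apply/same_envP => l lj; rewrite playS -e ifN.
Qed.

(** Player [j] moves exactly at the steps congruent to [j] modulo [n], so this says that the play
    consulted the response of [j] to the environment of [c] during its first [T] steps. *)
Definition visited b a T j c :=
  [exists s : 'I_T, (s %% n == j) && same_env j (play b a s) c].

Lemma visitedPn b a T j c :
  reflect (forall s, s < T -> s %% n = j -> ~~ same_env j (play b a s) c)
          (~~ visited b a T j c).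
Proof.
apply: (iffP existsPn) => [h s sT e|h s].
  by have := h (Ordinal sT); rewrite /= e eqxx.
by rewrite negb_and; case: eqP => //= e; apply: h.
Qed.

Lemma visitedP b a T j c :
  reflect (exists s, [/\ s < T, s %% n = j & same_env j (play b a s) c])
          (visited b a T j c).
Proof.
apply: (iffP existsP) => [[s /andP[/eqP ? ?]]|[s [sT e h]]]; first by exists s.
by exists (Ordinal sT); rewrite /= e eqxx.
Qed.

Lemma eq_visited b a b' a' T j c :
  (forall t, t < T -> play b a t = play b' a' t) ->
  visited b a T j c = visited b' a' T j c.
Proof. by move=> h; apply: eq_existsb => s; rewrite h. Qed.

(** All profiles sharing the environment of [c] are rewritten at once, which keeps the table
    consistent. *)
Definition override b (J : {set 'I_n}) c z : table :=
  [ffun i => [ffun x => if (i \in J) && same_env i c x then z i else b i x]].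

Lemma overrideE b J c z i x :
  override b J c z i x = if (i \in J) && same_env i c x then z i else b i x.
Proof. by rewrite /override !ffunE. Qed.

Lemma override_consistent b J c z : consistent b -> consistent (override b J c z).
Proof.
move=> /consistentP h; apply/consistentP => i x y s; rewrite !overrideE.
have -> : same_env i c x = same_env i c y.
  apply/idP/idP => k; first exact: same_env_trans s.
  by apply: (same_env_trans k); rewrite same_env_sym.
by rewrite (h _ _ _ s).
Qed.

Lemma play_override b a T J c z :
  (forall j, j \in J -> ~~ visited b a T j c) ->
  forall t, t <= T -> play (override b J c z) a t = play b a t.
Proof.
move=> h; elim => [//|t IH] tT.
apply/ffunP => j; rewrite !playS IH ?(ltnW tT) // overrideE.
case: eqP => // e; case: andP => // -[/h /visitedPn jJ].
by rewrite same_env_sym (negbTE (jJ t _ _)).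
Qed.

Definition free_profiles (J : {set 'I_n}) z : {set profile m} :=
  [set x : profile m | [forall i, (i \notin J) ==> (x i == z i)]].

Lemma card_free_profiles J z : #|free_profiles J z| = \prod_(i in J) m i.
Proof.
pose F i : pred 'I_(m i) := fun x => (i \in J) || (x == z i).
have -> : #|free_profiles J z| = #|(family F : simpl_pred (profile m))|.
  apply: eq_card => x; rewrite inE; apply/forallP/familyP => h i; move/(_ i): h.
    by rewrite [x i \in _]/(F i (x i)) /F; case: (i \in J).
  by rewrite [x i \in _]/(F i (x i)) /F; case: (i \in J).
rewrite card_family [RHS]big_mkcond /= /image_mem -big_enum /=.
elim: (enum _) => [|i s IH] /=; first by rewrite big_nil.
rewrite big_cons IH; congr (_ * _)%N; rewrite /F.
case: (i \in J) => /=; first by rewrite card_ord.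
by rewrite -[RHS](card1 (z i)); apply: eq_card.
Qed.

Definition states : {set profile m * table} := [set w | consistent w.2].
Implicit Types (E Q : {set profile m * table}) (w : profile m * table).

Notation path w := (play w.2 w.1).

(* An event forcing the responses at unvisited environments of the players in J
   to equal values known by time T costs a factor of prod_(i in J) m i:
   resampling these responses does not alter the play up to time T, so the
   original state can be recovered from the resampled one. *)
Lemma card_forced_responses T p (J : {set 'I_n}) E Q : p <= T ->
  {in E, forall w, consistent w.2 /\ forall j, j \in J ->
     ~~ visited w.2 w.1 T j (path w T) /\ w.2 j (path w T) = path w p j} ->
  {in E, forall w z, (w.1, override w.2 J (path w T) z) \in Q} ->
  #|E| * \prod_(i in J) m i <= #|Q|.
Proof.
move=> pT hE hQ; have [->|[w0 _]] := set_0Vmem E; first by rewrite cards0.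
rewrite -(card_free_profiles J w0.1) -cardsX.
pose f (u : profile m * table * profile m) :=
  (u.1.1, override u.1.2 J (path u.1 T) u.2).
rewrite -(card_in_imset (f := f)).
  apply/subset_leq_card/fintype.subsetP => _ /imsetP[[w z] /setXP[/= wE _] ->].
  exact: hQ.
move=> [[a b] z] [[a' b'] z'] /setXP[/= wE zF] /setXP[/= wE' zF'] [/= ea eb].
subst a'.
have [/consistentP cb fb] := hE _ wE; have [/consistentP cb' fb'] := hE _ wE'.
rewrite /= in cb fb cb' fb'.
(* Both plays agree up to [T] with the play of their common image. *)
have pe t : t <= T -> play b a t = play b' a t.
  move=> tT; rewrite -(@play_override b a T J (play b a T) z) //; last by move=> j /fb[].
  by rewrite eb (play_override (T := T)) // => j /fb'[].
(* Entries left alone are read off the image; an overridden one equals the action at time [p], which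
   both plays share. *)
have eo i x := congr1 (fun g : table => g i x) eb; rewrite /= in eo.
have ebb : b = b'.
  apply/ffunP => i; apply/ffunP => x; have := eo i x; rewrite !overrideE pe //.
  case: ifP => // /andP[iJ s] _.
  by rewrite -(cb _ _ _ s) -(cb' _ _ _ s) (fb' _ iJ).2 -[in LHS]pe // (fb _ iJ).2 pe.
subst b'; congr (_, _); apply/ffunP => i.
have [iJ|iJ] := boolP (i \in J).
  by have := eo i (play b a T); rewrite !overrideE iJ same_env_refl.
move: zF zF'; rewrite !inE => /forallP/(_ i)/implyP/(_ iJ)/eqP ->.
by move=> /forallP/(_ i)/implyP/(_ iJ)/eqP ->.
Qed.

(* Overriding responses at unvisited environments by the actions of A^T is
   undone by recording the overridden responses. *)
Lemma card_overridden_le T (J : {set 'I_n}) (D : profile m * table -> {set 'I_n}) E Q :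
  {in Q, forall w, consistent w.2 /\ D w \subset J} ->
  {in Q, forall w j, j \in D w -> ~~ visited w.2 w.1 T j (path w T)} ->
  (forall w w', (forall t, t <= T -> path w t = path w' t) -> D w = D w') ->
  {in Q, forall w, (w.1, override w.2 (D w) (path w T) (path w T)) \in E} ->
  #|Q| <= #|E| * \prod_(i in J) m i.
Proof.
move=> cQ vQ eD hE; have [->|[w0 _]] := set_0Vmem Q; first by rewrite cards0.
rewrite -(card_free_profiles J w0.1) -cardsX.
pose f w : profile m * table * profile m :=
  (w.1, override w.2 (D w) (path w T) (path w T),
   [ffun i => if i \in J then w.2 i (path w T) else w0.1 i]).
rewrite -(card_in_imset (f := f)).
  apply/subset_leq_card/fintype.subsetP => _ /imsetP[w wQ ->].
  apply/setXP; split; first exact: hE.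
  by rewrite inE; apply/forallP => i; apply/implyP => iJ; rewrite ffunE (negbTE iJ).
move=> [a b] [a' b'] wQ wQ' [/= ea eb ey]; subst a'.
have [/consistentP cb /fintype.subsetP sD] := cQ _ wQ.
have [/consistentP cb' _] := cQ _ wQ'; rewrite /= in cb cb'.
have pe t : t <= T -> play b a t = play b' a t.
  move=> tT; rewrite -(@play_override b a T (D (a, b)) (play b a T) (play b a T)) //;
    last exact: vQ.
  by rewrite eb (play_override (T := T)) //; exact: vQ.
(* The play up to [T] determines [D], so the same entries were overridden in both states. *)
have eDD : D (a, b) = D (a, b') by apply: eD.
congr (_, _); apply/ffunP => i; apply/ffunP => x.
have := congr1 (fun g : table => g i x) eb; rewrite /= !overrideE -eDD pe //.
case: ifP => // /andP[iD s] _.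
have := congr1 (fun g : profile m => g i) ey; rewrite /= !ffunE sD // pe // => e.
by rewrite -(cb _ _ _ s) -(cb' _ _ _ s) e.
Qed.

End ResponseTables.

Arguments play {n m} b a t : simpl never.

(** * Counting states *)

Lemma card_bigcup_le (I T : finType) (F : I -> {set T}) :
  #|\bigcup_i F i| <= \sum_i #|F i|.
Proof.
apply: (big_ind2 (fun (A : {set T}) k => #|A| <= k)); rewrite ?cards0 // => A k B l hA hB.
by rewrite (leq_trans (leq_card_setU A B)) // leq_add.
Qed.

(** Moving the window by one step drops a factor at the front and regains it at the back. *)
Lemma prod_round n (n_gt0 : 0 < n) (F : nat -> nat) r :
  \prod_(u < n) F ((r + u) %% n) = \prod_(i < n) F i.
Proof.
elim: r => [|r IH]; first by apply: eq_bigr => i _; rewrite add0n modn_small.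
rewrite -{}IH; case: n n_gt0 => // n _.
rewrite big_ord_recr big_ord_recl /= mulnC addn0.
rewrite addSnnS modnDr; congr (_ * _).
by apply: eq_bigr => i _; rewrite /bump /= addSnnS.
Qed.

Section CountingStates.

Variables (n : nat) (m : 'I_n -> nat).
Hypothesis n_gt0 : 0 < n.

Implicit Types (a c z : profile m) (b : table m) (i j : 'I_n).
Implicit Types w : profile m * table m.

Notation path w := (play w.2 w.1).

Definition mover t : 'I_n := Ordinal (ltn_pmod t n_gt0).

Definition prod_others j := \prod_(i in [set~ j]) m i.

(** * Upper bound: first hitting times *)

Definition first_hit T : {set profile m * table m} :=
  [set w in states m | table_PNE w.2 (path w T) &&
     [forall s : 'I_T, (0 < s) ==> ~~ table_PNE w.2 (path w s)]].

(* At the first hitting time T the environments of the players other than the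
   last mover are unvisited: otherwise the visit would have led to A^T earlier. *)
Lemma card_first_hit T : 0 < T ->
  #|first_hit T| * prod_others (mover T.-1) <= #|states m|.
Proof.
move=> T0; apply: (@card_forced_responses _ _ T T) => // w; rewrite inE => /andP[].
  rewrite inE => cw /andP[/table_PNEP pT /forallP noP]; split=> // j.
  rewrite in_setC1 => jT; split; last by rewrite pT.
  apply/visitedPn => s sT sj; apply/negP => es.
  have e : path w s.+1 = path w T.
    apply/ffunP => l; rewrite playS sj; case: (eqVneq l j) => [->|lj].
      by rewrite eqxx (consistentP _ cw _ _ _ es) -pT.
    by rewrite ifN // (same_envP _ _ _ es).
  (* Equality [s.+1 = T] would make [j] the last mover, which is excluded. *)
  have sT' : s.+1 < T.
    rewrite ltn_neqAle sT andbT; apply: contra jT => /eqP <- /=.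
    by apply/eqP/val_inj; rewrite /= sj.
  have := noP (Ordinal sT'); rewrite /= e => /negP; apply.
  exact/table_PNEP.
by rewrite inE => cw _ z; rewrite inE; apply: override_consistent.
Qed.

Definition hit_states t : {set profile m * table m} :=
  [set w in states m | [exists s : 'I_t.+1, (0 < s) && table_PNE w.2 (path w s)]].

Lemma hit_statesP t w :
  reflect (consistent w.2 /\ exists2 s, 0 < s <= t & table_PNE w.2 (path w s))
          (w \in hit_states t).
Proof.
rewrite inE [w \in _]inE; apply: (iffP andP) => -[cw h]; split=> //.
  by case/existsP: h => s /andP[s0 ?]; exists s; rewrite // s0 -ltnS ltn_ord.
case: h => s /andP[s0 st] ?.
by apply/existsP; exists (inord s); rewrite inordK // s0.
Qed.

Lemma card_hit_states_le q t : (forall i, q <= prod_others i) ->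
  #|hit_states t| * q <= t * #|states m|.
Proof.
move=> hq; apply: (@leq_trans (\sum_(T < t) #|first_hit T.+1| * q)).
  rewrite -big_distrl leq_mul2r; apply/orP; right => /=.
  apply: leq_trans (card_bigcup_le _); apply/subset_leq_card/fintype.subsetP => w.
  case/hit_statesP => cw [s /andP[s0 st] ps].
  have ex : exists s, (0 < s) && table_PNE w.2 (path w s) by exists s; rewrite s0.
  case: (ex_minnP ex) => -[//|T] /andP[_ pT] minT.
  have Tt : T < t by apply: leq_trans st; apply: minT; rewrite s0.
  apply/bigcupP; exists (Ordinal Tt) => //; rewrite inE [w \in _]inE cw pT /=.
  apply/forallP => r; apply/implyP => r0; apply/negP => pr.
  by have := minT r; rewrite r0 pr leqNgt ltn_ord => /(_ isT).
rewrite -[X in _ <= X * _]card_ord -sum_nat_const leq_sum // => T _.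
by apply: leq_trans (card_first_hit (ltn0Sn T)); rewrite leq_mul2l hq orbT.
Qed.

(** * Fresh play and returns to an earlier environment *)

Definition all_fresh b a T :=
  [forall t : 'I_T, ~~ visited b a t (mover t) (play b a t)].

Lemma all_freshP b a T :
  reflect (forall t, t < T -> ~~ visited b a t (mover t) (play b a t))
          (all_fresh b a T).
Proof.
by apply: (iffP forallP) => h t => [tT|]; [exact: (h (Ordinal tT))|exact: h].
Qed.

Lemma eq_all_fresh b a b' a' T :
  (forall t, t <= T -> play b a t = play b' a' t) ->
  all_fresh b a T = all_fresh b' a' T.
Proof.
move=> h; apply: eq_forallb => t; have tT := ltnW (ltn_ord t).
rewrite h //; congr negb; apply: eq_visited => s st.
by rewrite h // (leq_trans (ltnW st)).
Qed.

(** A return of the environment of [j], split into single moves: in the [k] steps from time [r] on,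
    each mover other than [j] draws its action of time [p]. Each such draw costs a factor. *)
Definition returning j p r k : {set profile m * table m} :=
  [set w in states m | all_fresh w.2 w.1 (r + k) &&
     [forall u : 'I_k, (mover (r + u) != j) ==>
        (path w (r + u).+1 (mover (r + u)) == path w p (mover (r + u)))]].

Lemma card_returningS j p r k : p <= r ->
  #|returning j p r k.+1| * (if mover (r + k) != j then m (mover (r + k)) else 1)
    <= #|returning j p r k|.
Proof.
move=> pr.
have sub : returning j p r k.+1 \subset returning j p r k.
  apply/fintype.subsetP => w; rewrite !inE => /and3P[-> /all_freshP f /forallP h] /=.
  apply/andP; split.
    by apply/all_freshP => t tk; apply: f; rewrite (leq_trans tk) // leq_add2l.
  apply/forallP => u; exact: (h (widen_ord (leqnSn k) u)).
(* When [j] itself moves nothing is forced, and the inclusion suffices. *)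
case: ifP => [nj|_]; last by rewrite muln1 subset_leq_card.
have -> : m (mover (r + k)) = \prod_(i in [set mover (r + k)]) m i by rewrite big_set1.
apply: (@card_forced_responses _ _ (r + k) p); first by rewrite (leq_trans pr) // leq_addr.
  move=> w; rewrite !inE => /and3P[cw /all_freshP f /forallP h]; split=> // i.
  rewrite inE => /eqP ->; split; first by apply: f; rewrite addnS.
  have := h ord_max; rewrite /= nj /= => /eqP <-.
  by rewrite playS /= eqxx.
move=> w wE z; have := fintype.subsetP sub _ wE; move: wE.
rewrite !inE => /and3P[_ /all_freshP f _] /and3P[cw f' /forallP h].
(* Resampling the fresh response of step [r + k] leaves the play up to that time unchanged, so the
   constraints of the first [k] steps survive. *)
have pe : forall t, t <= r + k -> play (override w.2 [set mover (r + k)] (path w (r + k)) z) w.1 t = path w t.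
  by apply: play_override => i; rewrite inE => /eqP ->; apply: f; rewrite addnS.
rewrite /= override_consistent // (eq_all_fresh pe) f' /=.
apply/forallP => u; rewrite !pe ?h //; first by rewrite (leq_trans pr) // leq_addr.
by rewrite -addnS leq_add2l.
Qed.

Lemma card_returning j p r k : p <= r ->
  #|returning j p r k| *
    \prod_(u < k) (if mover (r + u) != j then m (mover (r + u)) else 1)
    <= #|states m|.
Proof.
move=> pr; elim: k => [|k IH].
  rewrite big_ord0 muln1; apply/subset_leq_card/fintype.subsetP => w.
  by rewrite !inE => /andP[].
rewrite big_ord_recr /= mulnCA mulnA mulnC; apply: leq_trans IH.
rewrite mulnC -mulnA mulnC leq_mul2r mulnC; apply/orP; right.
by rewrite mulnC card_returningS.
Qed.

Definition bad_return j p r : {set profile m * table m} :=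
  [set w in states m | all_fresh w.2 w.1 r && same_env j (path w p) (path w r)].

(* Over a full round, every player other than j must freshly draw the action it
   had at time p. *)
Lemma card_bad_return j p r : p + n <= r ->
  #|bad_return j p r| * prod_others j <= #|states m|.
Proof.
move=> pr; have nr : n <= r by rewrite (leq_trans _ pr) // leq_addl.
(* The last full round before [r] starts no earlier than [p], so the actions to be redrawn are
   already known. *)
have pr' : p <= r - n by rewrite leq_subRL // addnC.
apply: leq_trans (card_returning j n pr').
have -> : prod_others j =
    \prod_(u < n) (if mover (r - n + u) != j then m (mover (r - n + u)) else 1).
  rewrite /prod_others big_mkcond /=.
  pose F k := if insub k is Some i then if i != j then m i else 1 else 1.
  transitivity (\prod_(i < n) F i).
    by apply: eq_bigr => i _; rewrite in_setC1 /F valK.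
  rewrite -(prod_round n_gt0 F (r - n)); apply: eq_bigr => u _.
  by rewrite /F -[((r - n + u) %% n)]/(val (mover (r - n + u))) valK.
rewrite leq_mul2r subset_leq_card ?orbT //.
apply/fintype.subsetP => w; rewrite !inE => /and3P[-> f /same_envP e].
rewrite subnK // f /=; apply/forallP => u; apply/implyP => /e ->.
have un := ltn_ord u.
(* A player moves only once per round, so its action at time [r] is the one drawn in the last
   round. *)
rewrite eq_sym (@play_still _ _ _ _ _ (r - n + u).+1) //.
  by rewrite -{2}(subnK nr) ltn_add2l.
move=> v /andP[v1 v2] /=; apply/negP => /eqP h.
have : n %| v - (r - n + u) by rewrite -eqn_mod_dvd ?(ltnW v1) //; apply/eqP.
move=> /dvdn_leq; lia.
Qed.

(** * Lower bound: hits right after the moves of a fixed player *)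

Section LowerBound.

Variable i0 : 'I_n.

(* The visit of j at its last move before T is exempted: it makes j play a best
   response in A^T for free. *)
Definition good T : {set profile m * table m} :=
  [set w in states m | all_fresh w.2 w.1 T &&
     [forall j, (j != i0) ==> [forall s : 'I_T, (s %% n == j) && (s + n < T) ==>
        ~~ same_env j (path w s) (path w T)]]].

Lemma goodP T w :
  reflect [/\ consistent w.2, all_fresh w.2 w.1 T &
    forall j s, j != i0 -> s %% n = j -> s + n < T ->
      ~~ same_env j (path w s) (path w T)] (w \in good T).
Proof.
rewrite inE [w \in _]inE; apply: (iffP and3P) => -[cw f h]; split=> //.
  move=> j s ji sj sT; have sT' : s < T by rewrite (leq_trans _ sT) // ltnS leq_addr.
  have /forallP/(_ (Ordinal sT'))/implyP := implyP (forallP h j) ji.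
  by apply; rewrite /= sj eqxx.
apply/forallP => j; apply/implyP => ji; apply/forallP => s.
by apply/implyP => /andP[/eqP sj]; apply: h.
Qed.

Definition fresh_hit T : {set profile m * table m} :=
  [set w in good T | table_PNE w.2 (path w T)].

(** Overriding the unvisited responses of the players other than [i0] by their actions in A^T turns
    A^T into a PNE without altering the play up to [T]. *)
Lemma card_good_le T : 0 < T -> mover T.-1 = i0 ->
  #|good T| <= #|fresh_hit T| * prod_others i0.
Proof.
case: T => // T _ /= mT.
pose D w := [set j | (j != i0) && ~~ visited w.2 w.1 T.+1 j (path w T.+1)].
apply: (@card_overridden_le _ _ T.+1 _ D).
- move=> w /goodP[cw _ _]; split=> //; apply/fintype.subsetP => j.
  by rewrite !inE => /andP[].
- by move=> w _ j; rewrite inE => /andP[].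
- move=> w w' e; apply/setP => j; rewrite !inE (@eq_visited _ _ _ _ w'.2 w'.1) ?e //.
  by move=> t tT; apply/e/ltnW.
move=> w /goodP[cw f h]; set b' := override _ _ _ _.
have pe : forall t, t <= T.+1 -> play b' w.1 t = path w t.
  by apply: play_override => j; rewrite inE => /andP[].
have cb' : consistent b' by exact: override_consistent.
rewrite inE; apply/andP; split.
  apply/goodP; split; rewrite ?(eq_all_fresh pe) //= => j s ji sj sT.
  by rewrite !pe ?h // (leq_trans _ (ltnW sT)) // leq_addr.
rewrite /= pe //; apply/table_PNEP => j; rewrite /b' overrideE same_env_refl andbT inE.
case: (eqVneq j i0) => [->|ji] /=.
  (* [i0] has just moved, so it already plays its response to the current environment. *)
  have e0 : i0 = T %% n :> nat by rewrite -mT.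
  rewrite -(consistentP _ cw _ _ _ (play_step_env w.2 w.1 e0)).
  by rewrite playS e0 eqxx.
(* Goodness leaves only the last move of [j] as the visit, and [j] has kept the action chosen
   there. *)
case: ifPn => // /negPn/visitedP[s [sT sj es]]; rewrite -(consistentP _ cw _ _ _ es).
rewrite (@play_still _ _ _ _ _ s.+1) ?playS ?sj ?eqxx // => v /andP[v1 v2].
apply/negP => /eqP vj.
have : n %| v - s by rewrite -eqn_mod_dvd ?(ltnW v1) // sj vj.
have : ~~ (s + n < T.+1) by apply/negP => /(h j s ji sj); rewrite es.
by move=> ? /dvdn_leq; lia.
Qed.

(** The first union holds the repetitions at a move, [c.+1] rounds after the earlier visit; the
    second holds the returns at time [T] itself. *)
Lemma bad_return_cover T : states m \subset good T :|:
  (\bigcup_(t < T) \bigcup_(c < t %/ n) bad_return (mover t) (t - n * c.+1) t) :|: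
  \bigcup_(s < T - n) bad_return (mover s) s T.
Proof.
apply/fintype.subsetP => w; rewrite inE => cw; rewrite !finset.in_setU -orbA.
have [f|] := boolP (all_fresh w.2 w.1 T); last first.
  rewrite negb_forall => /existsP[t0]; rewrite negbK => vt0.
  have ex : exists t, visited w.2 w.1 t (mover t) (path w t) by exists t0.
  (* The earliest repetition is taken, so that all moves before it are fresh, as [bad_return]
     requires. *)
  case: (ex_minnP ex) => t vt mint; have tT : t < T.
    by apply: leq_ltn_trans (ltn_ord t0); apply: mint.
  apply/orP; right; apply/orP; left; apply/bigcupP; exists (Ordinal tT) => //=.
  case/visitedP: vt => s [st sm es].
  have dv : n %| t - s by rewrite -eqn_mod_dvd ?(ltnW st) //; apply/eqP.
  have [c ec] := dvdnP dv.
  have c0 : 0 < c by case: c ec => //; lia.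
  have ct : c.-1 < t %/ n by rewrite prednK // leq_divRL // -ec leq_subr.
  apply/bigcupP; exists (Ordinal ct) => //=; rewrite prednK // mulnC -ec subKn ?(ltnW st) //.
  rewrite !inE cw es andbT /=; apply/all_freshP => u ut; apply/negP => /mint.
  by rewrite leqNgt ut.
have [//|ng] := boolP (w \in good T).
apply/orP; right; apply/orP; right; move: ng.
rewrite inE [w \in _]inE cw f /= negb_forall => /existsP[j].
rewrite negb_imply => /andP[ji]; rewrite negb_forall => /existsP[s].
rewrite negb_imply negbK => /andP[/andP[/eqP sj sT] es].
have sT' : s < T - n by lia.
apply/bigcupP; exists (Ordinal sT') => //; rewrite !inE cw f /=.
by rewrite (_ : mover s = j) //; apply/val_inj.
Qed.

Lemma card_states_le_good q T : (forall i, q <= prod_others i) ->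
  #|states m| * q <= #|good T| * q + (\sum_(t < T) t %/ n + (T - n)) * #|states m|.
Proof.
move=> hq; have := subset_leq_card (bad_return_cover T).
have hbad j p r : p + n <= r -> #|bad_return j p r| * q <= #|states m|.
  by move=> /(card_bad_return j); apply: leq_trans; rewrite leq_mul2l hq orbT.
move=> h; apply: leq_trans (_ : (#|good T| + (\sum_(t < T) \sum_(c < t %/ n)
   #|bad_return (mover t) (t - n * c.+1) t| + \sum_(s < T - n) #|bad_return (mover s) s T|)) * q <= _).
  rewrite leq_mul2r; apply/orP; right; apply: (leq_trans h).
  rewrite addnA (leq_trans (leq_card_setU _ _)) // leq_add ?card_bigcup_le //.
  rewrite (leq_trans (leq_card_setU _ _)) // leq_add2l.
  by rewrite (leq_trans (card_bigcup_le _)) // leq_sum // => t _; exact: card_bigcup_le.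
rewrite !mulnDl leq_add2l leq_add // !big_distrl /=.
  apply: leq_sum => t _; rewrite big_distrl -[X in _ <= X * _]card_ord -sum_nat_const.
  apply: leq_sum => c _; apply: hbad.
  have : n * c.+1 <= t by rewrite mulnC -leq_divRL //.
  by rewrite mulnS; lia.
rewrite -[X in _ <= X * _]card_ord -sum_nat_const leq_sum // => s _.
by apply: hbad; have := ltn_ord s; lia.
Qed.

(** The quotient is constant on blocks of length [n]; doubling avoids a division. *)
Lemma sum_divn k : (\sum_(t < n * k.+1) t %/ n) * 2 = n * (k * k.+1).
Proof.
elim: k => [|k IH].
  by rewrite muln1 big1 ?mul0n ?muln0 // => t _; rewrite divn_small.
rewrite [n * k.+2]mulnS addnC big_split_ord /= mulnDl IH.
rewrite (eq_bigr (fun=> k.+1)) => [|u _]; last first.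
  by rewrite mulnC divnMDl // divn_small ?addn0.
by rewrite sum_nat_const card_ord; lia.
Qed.

(** The time just after move number [k] of [i0], counted from zero. *)
Definition move_time k := (i0 + n * k).+1.

Lemma num_bad_returns_le k :
  (\sum_(t < move_time k) t %/ n + (move_time k - n)) * 2 <= n * (k * (k + 3)).
Proof.
have i0n := ltn_ord i0.
have le1 : move_time k <= n * k.+1 by rewrite mulnS /move_time; lia.
have le2 : \sum_(t < move_time k) t %/ n <= \sum_(t < n * k.+1) t %/ n.
  rewrite -!(big_mkord predT (fun t => t %/ n)).
  by rewrite [X in _ <= X](big_cat_nat (leq0n _) le1) leq_addr.
(* The factor [k * (k + 3)] is [k * k.+1] from repetitions at moves plus [2 * k] from returns at the
   final time. *)
have := sum_divn k; rewrite mulnDl; have : move_time k - n <= n * k by lia.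
by rewrite /= in le2 *; nia.
Qed.

(** A PNE is absorbing: after a hit at the earlier time, [i0] would face at its later move the
    environment of its earlier one, against freshness. *)
Lemma fresh_hit_disjoint k l : k != l ->
  [disjoint fresh_hit (move_time k) & fresh_hit (move_time l)].
Proof.
wlog kl : k l / k < l => [hw|_].
  by rewrite neq_ltn => /orP[kl|lk]; [|rewrite disjoint_sym]; apply: hw; rewrite // neq_ltn ?kl ?lk.
apply/pred0P => w /=; apply/negP => /andP[].
rewrite inE => /andP[/goodP[cw _ _] pk]; rewrite inE => /andP[/goodP[_ f _] _].
have kl' : move_time k <= i0 + n * l by rewrite /move_time ltn_add2l ltn_pmul2l.
have mi r : mover (i0 + n * r) = i0.
  by apply/val_inj; rewrite /= addnC mulnC modnMDl modn_small.
have /visitedPn/(_ (i0 + n * k)) := all_freshP _ _ _ f _ (ltnSn (i0 + n * l)).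
rewrite mi (play_PNE pk kl') => /(_ kl').
have e : (i0 + n * k) %% n = i0 by have := congr1 val (mi k).
by move=> /(_ e)/negP; apply; apply: play_step_env.
Qed.

(** The lower bound with denominators cleared, summed over the first [t %/ n] moves of [i0]. *)
Lemma card_hit_states_ge t : (forall i, prod_others i0 <= prod_others i) ->
  2 * (t %/ n) * prod_others i0 * #|states m| <=
    2 * prod_others i0 ^ 2 * #|hit_states t| + #|states m| * (n * (t %/ n) ^ 3).
Proof.
set q := prod_others i0; set k := t %/ n => hq; set S := #|states m|.
have step r : 2 * (S * q) <= 2 * (#|fresh_hit (move_time r)| * q ^ 2) + n * (r * (r + 3)) * S.
  have h1 := card_states_le_good (move_time r) hq.
  have h2 : #|good (move_time r)| <= #|fresh_hit (move_time r)| * q.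
    apply: card_good_le => //; apply/val_inj.
    by rewrite /= addnC mulnC modnMDl modn_small.
  have h3 := num_bad_returns_le r.
  move: h1 h2 h3; rewrite -/q -/S.
  set B := (\sum_(_ < _) _ + _); set G := #|good _|; set F := #|fresh_hit _| => h1 h2 h3.
  have : G * q <= F * q * q by rewrite leq_mul2r h2 orbT.
  have : B * 2 * S <= n * (r * (r + 3)) * S by rewrite leq_mul2r h3 orbT.
  by lia.
(* Each term satisfies [l * (l + 3) <= l.+1 ^ 3 - l ^ 3]. *)
have cubes : \sum_(r < k) r * (r + 3) <= k ^ 3.
  elim: k => [|l IH]; first by rewrite big_ord0.
  by rewrite big_ord_recr /= !expnS !expn0 in IH *; lia.
have hits : \sum_(r < k) #|fresh_hit (move_time r)| <= #|hit_states t|.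
  have -> : \sum_(r < k) #|fresh_hit (move_time r)| =
      #|\bigcup_(r < k) fresh_hit (move_time r)|.
    rewrite -sum1_card partition_disjoint_bigcup; last first.
      by move=> r s rs; apply: fresh_hit_disjoint.
    by apply: eq_bigr => r _; rewrite sum1_card.
  apply/subset_leq_card/fintype.subsetP => w /bigcupP[r _].
  rewrite inE => /andP[/goodP[cw _ _] pw]; apply/hit_statesP; split=> //.
  exists (move_time r) => //=; apply: leq_trans (leq_trunc_div t n).
  have := ltn_ord r; have := ltn_ord i0; rewrite -/k /move_time => h1 h2.
  have : n * r.+1 <= n * k by rewrite leq_mul2l h2 orbT.
  by rewrite mulnS mulnC; lia.
have : \sum_(r < k) 2 * (S * q) <= \sum_(r < k)
    (2 * (#|fresh_hit (move_time r)| * q ^ 2) + n * (r * (r + 3)) * S).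
  by apply: leq_sum => r _; exact: step.
rewrite sum_nat_const card_ord big_split /= -big_distrr -!big_distrl -big_distrr /=.
set F := \sum_(r < k) _ in hits *; set C := \sum_(r < k) _ in cubes *.
move=> h; have : F * q ^ 2 <= #|hit_states t| * q ^ 2 by rewrite leq_mul2r hits orbT.
have : n * C * S <= n * k ^ 3 * S by rewrite leq_mul2r leq_mul2l cubes !orbT.
move: h; move: (q ^ 2) (k ^ 3) => q2 k3.
clear step hits cubes hq; clearbody k q S F C; move: #|_| => H.
by nia.
Qed.

End LowerBound.
End CountingStates.

Import Order.TTheory GRing.Theory Num.Theory numFieldNormedType.Exports.
Local Open Scope ring_scope.
Local Open Scope classical_set_scope.

(** * Order events of exchangeable families *)

Lemma measurable_ltr d (T : measurableType d) (R : realType) (f g : T -> R) :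
  measurable_fun setT f -> measurable_fun setT g -> measurable [set w | f w < g w].
Proof.
move=> mf mg; have := measurable_fun_ltr mf mg; move=> /(_ measurableT [set true]).
by rewrite setTI; apply.
Qed.

Lemma measurable_ler d (T : measurableType d) (R : realType) (f g : T -> R) :
  measurable_fun setT f -> measurable_fun setT g -> measurable [set w | f w <= g w].
Proof.
move=> mf mg; have := measurable_fun_ler mf mg; move=> /(_ measurableT [set true]).
by rewrite setTI; apply.
Qed.

Lemma measurable_eqr d (T : measurableType d) (R : realType) (f g : T -> R) :
  measurable_fun setT f -> measurable_fun setT g -> measurable [set w | f w = g w].
Proof.
move=> mf mg; rewrite (_ : [set _ | _] = [set w | f w <= g w] `&` [set w | g w <= f w]).
  by apply: measurableI; exact: measurable_ler.
by apply/seteqP; split=> w /=; [move=> ->|case=> h k; apply/le_anti; rewrite h].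
Qed.

Lemma measurable_forall d (T : measurableType d) (I : finType) (F : I -> set T) :
  (forall i, measurable (F i)) -> measurable [set w | forall i, F i w].
Proof.
move=> mF; rewrite (_ : [set _ | _] = \bigcap_(i in setT) F i); last first.
  by apply/seteqP; split=> w /= h i //; exact: h.
by apply: fin_bigcap_measurable.
Qed.

(** A pi-system generating the product sigma-algebra on [K -> R], on which laws of families are
    compared. *)
Definition rectangles (R : realType) (K : finType) : set (set (K -> R)) :=
  [set [set u | forall k, B k (u k)] | B in [set B : K -> set R | forall k, measurable (B k)]].

Section OrderEvents.
Context d (T : measurableType d) (R : realType) (K : finType).
Let Omega := g_sigma_algebraType (@rectangles R K).

Lemma measurable_coordinate (k : K) : measurable_fun setT (fun u : Omega => u k : R).
Proof.
move=> _ B mB; rewrite setTI; apply: sub_sigma_algebra.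
exists (fun l => if l == k then B else setT).
  by move=> l /=; case: ifP => // _; exact: measurableT.
apply/seteqP; split=> u /=; first by move=> /(_ k); rewrite eqxx.
by move=> Bu l; case: eqP => // ->.
Qed.

Lemma measurable_family (X : K -> T -> R) : (forall k, measurable_fun setT (X k)) ->
  measurable_fun setT (fun w => (X^~ w : Omega)).
Proof.
move=> mX; apply: (@measurability _ _ T Omega setT (fun w => (X^~ w : Omega)) (@rectangles R K)) => //.
move=> _ [_ [B mB <-] <-]; rewrite setTI; apply: measurable_forall => k.
by rewrite -[X in measurable X]setTI; exact: mX.
Qed.

Lemma rectangles_setI : setI_closed (@rectangles R K).
Proof.
move=> _ _ [B mB <-] [C mC <-]; exists (fun k => B k `&` C k).
  by move=> k; apply: measurableI.
by apply/seteqP; split=> u /= h; [split=> k; case: (h k)|move=> k; split; case: h => h1 h2].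
Qed.

Lemma rectanglesT : @rectangles R K setT.
Proof.
exists (fun=> setT) => [k|]; first exact: measurableT.
by apply/seteqP.
Qed.

(** The pushforwards agree on rectangles, hence on the sigma-algebra they generate, which contains
    the order events. Two measures are allowed so that [P] can be restricted to different initial
    profiles. *)
Lemma order_event_same_law (mu nu : {measure set T -> \bar R}) (X Y : K -> T -> R)
    (S : rel K) :
  (mu setT < +oo)%E ->
  (forall k, measurable_fun setT (X k)) -> (forall k, measurable_fun setT (Y k)) ->
  (forall B : K -> set R, (forall k, measurable (B k)) ->
     mu [set w | forall k, B k (X k w)] = nu [set w | forall k, B k (Y k w)]) ->
  mu [set w | forall k l, S k l -> X k w < X l w] =
  nu [set w | forall k l, S k l -> Y k w < Y l w].
Proof.
move=> fin mX mY h.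
have fX := measurable_family mX; have fY := measurable_family mY.
set E := fun u : Omega => forall k l, S k l -> u k < u l.
have mE : measurable (E : set Omega).
  rewrite (_ : E = [set u : Omega | forall p : K * K,
      (if S p.1 p.2 then [set u : Omega | u p.1 < u p.2] else setT) u]); last first.
    apply/seteqP; split=> u /= h' => [[k l]|k l kl] /=.
      by case: ifP => // kl; exact: h'.
    by have := h' (k, l); rewrite /= kl.
  apply: measurable_forall => p; case: ifP => // _.
  by apply: measurable_ltr; exact: measurable_coordinate.
apply: (@measure_unique _ R Omega (@rectangles R K) (fun=> setT) _ _ _ _
  (pushforward mu (fun w => X^~ w : Omega)) (pushforward nu (fun w => Y^~ w : Omega))) mE => //.
- exact: rectangles_setI.
- by move=> _; exact: rectanglesT.
- by rewrite bigcup_const.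
- by move=> _ [B mB <-]; exact: h.
Qed.

End OrderEvents.

(** By independence the joint law is the product law, and every section of the diagonal is a single
    point, null for the law of [Y]. *)
Lemma independent_tie_null d (T : measurableType d) (R : realType)
    (P : probability T R) (X Y : T -> R) :
  measurable_fun setT X -> measurable_fun setT Y ->
  (forall A B, measurable A -> measurable B ->
     P (X @^-1` A `&` Y @^-1` B) = (P (X @^-1` A) * P (Y @^-1` B))%E) ->
  (forall x, P (Y @^-1` [set x]) = 0%E) ->
  P [set w | X w = Y w] = 0%E.
Proof.
move=> mX mY ind atomless.
pose X' : {mfun T >-> R} := HB.pack X (isMeasurableFun.Build _ _ _ _ X mX).
pose Y' : {mfun T >-> R} := HB.pack Y (isMeasurableFun.Build _ _ _ _ Y mY).
pose pX : probability R R := distribution P X'.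
pose pY : probability R R := distribution P Y'.
pose XY w := (X w, Y w).
have mXY : measurable_fun setT XY by exact: measurable_fun_pair.
pose D := [set z : R * R | z.1 = z.2].
have mD : measurable D by apply: measurable_eqr; [exact: measurable_fst|exact: measurable_snd].
have <- : (pX \x pY)%E D = P [set w | X w = Y w].
  exact: (product_measure_unique (m' := pushforward P XY)).
apply: integral0_eq => x _ /=; rewrite (_ : xsection D x = [set x]); first exact: atomless.
by apply/seteqP; split=> y; rewrite /xsection /= inE; exact: esym.
Qed.

(** * From payoffs to tables *)

Lemma measure_ae_partition d (T : measurableType d) (R : realType)
    (P : {measure set T -> \bar R}) (I : finType) (F : I -> set T) (A : set T) :
  (forall i, measurable (F i)) -> trivIset setT F ->
  P (~` \bigcup_i F i) = 0%E -> measurable A ->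
  P A = (\sum_(i : I) P (A `&` F i))%E.
Proof.
move=> mF tF nF mA.
have mU : measurable (\bigcup_i F i) by apply: fin_bigcup_measurable.
rewrite -[in LHS](setUIDK A (\bigcup_i F i)) setI_bigcupr.
have mAF i : measurable (A `&` F i) by exact: measurableI.
rewrite measureU; last 3 first.
- by apply: fin_bigcup_measurable.
- exact: measurableD.
- by apply/seteqP; split=> // w /= [[i _ [_ Fw]] [_ nw]]; apply: nw; exists i.
rewrite [X in (_ + X)%E](_ : _ = 0%E); last first.
  by apply: (subset_measure0 _ _ _ nF) => [||w []//]; [exact: measurableD|exact: measurableC].
rewrite adde0 measure_fin_bigcup //; last 2 first.
- exact: finite_finset.
- apply/trivIsetP => i j _ _ ij; rewrite setIACA.
  by move/trivIsetP : tF => /(_ i j Logic.I Logic.I ij) ->; rewrite setI0.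
rewrite [RHS]fsbig_seq ?index_enum_uniq //.
by apply: eq_fsbigl; apply/seteqP; split=> i //= _; exact: mem_index_enum.
Qed.

(** * Single-action updates and best responses *)

Section Upd.
Variables (n : nat) (m : 'I_n -> nat).
Implicit Types (a c : profile m).

Lemma upd_in a i x : upd a i x i = x.
Proof. by rewrite /upd ffunE mathcomp_extra.dfwithin. Qed.

Lemma upd_out a i x j : i != j -> upd a i x j = a j.
Proof. by move=> ij; rewrite /upd ffunE mathcomp_extra.dfwithout. Qed.

Lemma same_env_upd a i x : same_env i a (upd a i x).
Proof. by apply/same_envP => l; rewrite eq_sym => ?; rewrite upd_out. Qed.

Lemma upd_id a i : upd a i (a i) = a.
Proof.
apply/ffunP => j; case: (eqVneq i j) => [<-|ij]; first by rewrite upd_in.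
by rewrite upd_out.
Qed.

Lemma upd_upd a i x y : upd (upd a i x) i y = upd a i y.
Proof.
apply/ffunP => j; case: (eqVneq i j) => [<-|ij]; first by rewrite !upd_in.
by rewrite !upd_out.
Qed.

Lemma same_env_eq_upd a c i x : same_env i a c -> upd a i x = upd c i x.
Proof.
move=> /same_envP h; apply/ffunP => j; case: (eqVneq i j) => [<-|ij]; first by rewrite !upd_in.
by rewrite !upd_out // h // eq_sym.
Qed.

Section Response.
Variable R : realType.
Implicit Types (u v : 'I_n -> profile m -> R).

Lemma best_response_max u i a x : u i (upd a i x) <= u i (upd a i (best_response u i a)).
Proof. by rewrite /best_response; case: arg_maxP => // y _; apply. Qed.

(** The choice of maximizer, ties included, depends only on payoff comparisons; measurability of the
    hitting event rests on this. *)
Lemma eq_best_response u v :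
  (forall i a c, (u i a <= u i c) = (v i a <= v i c)) ->
  forall i a, best_response u i a = best_response v i a.
Proof.
move=> h i a; rewrite /best_response /Order.arg_max /extremum.
congr odflt; apply: eq_pick => x /=; apply: eq_forallb => y /=.
by rewrite h.
Qed.

Lemma eq_clockwork u v : (forall i a, best_response u i a = best_response v i a) ->
  forall a t, clockwork u a t = clockwork v a t.
Proof.
move=> h a; elim=> //= t ->; apply/ffunP => j; rewrite !ffunE.
by rewrite h.
Qed.

Lemma clockwork_play u (b : table m) : (forall i a, best_response u i a = b i a) ->
  forall a t, clockwork u a t = play b a t.
Proof.
move=> h a; elim=> //= t ->; apply/ffunP => j; rewrite playS ffunE.
by rewrite h.
Qed.

End Response.
End Upd.

(** * Payoff orders that realize a given table *)

Section TableEvents.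
Variables (n : nat) (m : 'I_n -> nat).
Let K := ('I_n * profile m)%type.
Implicit Types (b : table m) (k l : K).

(** The comparisons that must hold strictly for [b] to be the response table: [l] is the prescribed
    response and [k] another action in the same environment. *)
Definition beaten b : rel K := fun k l =>
  [&& k.1 == l.1, same_env k.1 k.2 l.2, k.2 k.1 != b k.1 k.2 & l.2 l.1 == b l.1 l.2].

Definition swap b b' k : K :=
  (k.1, upd k.2 k.1 (tperm (b k.1 k.2) (b' k.1 k.2) (k.2 k.1))).

Lemma consistent_upd b i a x : consistent b -> b i (upd a i x) = b i a.
Proof. by move=> /consistentP cb; apply: cb; rewrite same_env_sym same_env_upd. Qed.

Lemma swapK b b' : consistent b -> consistent b' -> involutive (swap b b').
Proof.
move=> cb cb' [i a]; rewrite /swap /=; congr pair.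
by rewrite !consistent_upd // upd_in tpermK upd_upd upd_id.
Qed.

Lemma same_env_swap b b' k l : k.1 = l.1 ->
  same_env k.1 (swap b b' k).2 (swap b b' l).2 = same_env k.1 k.2 l.2.
Proof.
case: k l => i a [_ c] /= <-; apply/same_envP/same_envP => h j ji; move: (h j ji);
  by rewrite !upd_out 1?eq_sym.
Qed.

(** The transposition fixes environments and carries the response of [b], and no other action, to
    that of [b']. *)
Lemma beaten_swap b b' k l : consistent b -> consistent b' ->
  beaten b' (swap b b' k) (swap b b' l) = beaten b k l.
Proof.
move=> cb cb'; rewrite /beaten /=; case: eqP => //= e.
rewrite same_env_swap // !consistent_upd // !upd_in; congr [&& _, ~~ _ & _].
  by rewrite -{2}(tpermL (b k.1 k.2) (b' k.1 k.2)) (inj_eq perm_inj).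
by rewrite -{2}(tpermL (b l.1 l.2) (b' l.1 l.2)) (inj_eq perm_inj).
Qed.

Section Payoffs.
Variables (R : realType) (u : 'I_n -> profile m -> R).

Definition strict_table b :=
  forall k l, beaten b k l -> u k.1 k.2 < u l.1 l.2.

Lemma strict_table_best_response b : consistent b -> strict_table b ->
  forall i a, best_response u i a = b i a.
Proof.
move=> cb h i a; apply/eqP/negP => /negP ne.
have := best_response_max u a (b i a); rewrite leNgt => /negP; apply.
apply: (h (i, upd a i _) (i, upd a i _)); rewrite /beaten /= !consistent_upd // !upd_in !eqxx ne.
rewrite /= andbT; apply: (@same_env_trans _ _ _ _ a); last exact: same_env_upd.
by rewrite same_env_sym same_env_upd.
Qed.

Lemma strict_table_exists :
  (forall i a c, a != c -> u i a != u i c) ->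
  exists b, consistent b /\ strict_table b.
Proof.
move=> ne; pose b : table m := [ffun i => [ffun a => best_response u i a]].
have bE i a : b i a = best_response u i a by rewrite /b !ffunE.
have cb : consistent b.
  apply/consistentP => i a c s; rewrite !bE; apply/eqP/negP => /negP d.
  have h1 := best_response_max u a (best_response u i c).
  have h2 := best_response_max u c (best_response u i a).
  rewrite -!(same_env_eq_upd _ s) in h2.
  (* Two different maximizers in one environment would be tied. *)
  have := ne i (upd a i (best_response u i c)) (upd a i (best_response u i a)).
  rewrite eq_le h1 h2 => /(_ _)/negP; apply=> //.
  by apply: contra d => /eqP/(congr1 (fun g : profile m => g i)); rewrite !upd_in => ->.
exists b; split=> // -[i a] [j c]; rewrite /beaten /= => /and4P[/eqP ij].
subst j => s na /eqP ec; rewrite lt_neqAle; apply/andP; split.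
  apply: ne; apply: contra na => /eqP ->; exact/eqP.
have := best_response_max u c (a i).
by rewrite -bE -ec upd_id -(same_env_eq_upd _ s) upd_id.
Qed.

End Payoffs.
End TableEvents.

(** * Uniform law of the initial profile and the table *)

Section Setup.
Context d (T : measurableType d) (R : realType) (P : probability T R).
Variables (n : nat) (m : 'I_n -> nat).
Variables (U : 'I_n -> profile m -> T -> R) (A0 : T -> profile m).
Hypothesis setup : random_game_setup P U A0.
Let K := ('I_n * profile m)%type.
Let X (k : K) w := U k.1 k.2 w.

Lemma setup_measurable_payoff i a : measurable_fun setT (U i a).
Proof. by case: setup => -[]. Qed.

Lemma setup_measurable_init a : measurable (A0 @^-1` [set a]).
Proof. by case: setup => -[]. Qed.

Lemma setup_rectangle a0 (B : K -> set R) : (forall k, measurable (B k)) ->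
  P ([set w | forall k, B k (X k w)] `&` A0 @^-1` [set a0]) =
  ((#|{: profile m}|%:R^-1)%:E *
     \big[*%E/1%E]_(i < n) \big[*%E/1%E]_(a : profile m) P (U i a @^-1` B (i, a)))%E.
Proof.
move=> mB; case: setup => _ uni ind _ _.
rewrite -(uni a0) -(ind (fun i a => B (i, a))) // setIC; congr (P (_ `&` _)).
by apply/seteqP; split=> w /= h => [i a|[i a]]; [exact: (h (i, a))|exact: h].
Qed.

Definition table_event b := [set w | strict_table (fun i a => U i a w) b].

Lemma measurable_table_event b : measurable (table_event b).
Proof.
rewrite (_ : table_event b = [set w | forall p : K * K,
    (if beaten b p.1 p.2 then [set w | X p.1 w < X p.2 w] else setT) w]).
  apply: measurable_forall => p; case: ifP => // _.
  by apply: measurable_ltr; exact: setup_measurable_payoff.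
apply/seteqP; split=> w /= h => [[k l]|k l kl] /=.
  by case: ifP => // kl; exact: h.
by have := h (k, l); rewrite /= kl.
Qed.

(** Inconsistent tables receive the empty cell, so that cells are indexed by the whole finite
    type. *)
Definition cell (w : profile m * table m) : set T :=
  if consistent w.2 then table_event w.2 `&` A0 @^-1` [set w.1] else set0.

Lemma measurable_cell w : measurable (cell w).
Proof.
rewrite /cell; case: ifP => // _.
by apply: measurableI; [exact: measurable_table_event|exact: setup_measurable_init].
Qed.

Lemma trivIset_cell : trivIset setT cell.
Proof.
apply/trivIsetP => -[a b] [a' b'] _ _ ne; apply/seteqP; split=> // w.
rewrite /cell /=; case: ifP => cb; last by case.
case: ifP => cb'; last by case.
case=> -[/(strict_table_best_response cb) h e] [/(strict_table_best_response cb') h' e'].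
move/eqP: ne; apply; rewrite /= in e e'; rewrite -e -e'; congr pair.
by apply/ffunP => i; apply/ffunP => c; rewrite -h -h'.
Qed.

(* Swapping the payoffs of the actions b i a and b' i a for all i and a is a
   permutation of i.i.d. payoffs which exchanges the two tables. *)
Lemma cell_equiprobable w w' : consistent w.2 -> consistent w'.2 ->
  P (cell w) = P (cell w').
Proof.
case: w w' => a b [a' b'] /= cb cb'; rewrite /cell /= cb cb'.
have fin : (mrestr P (setup_measurable_init a) setT < +oo)%E.
  by rewrite /mrestr setTI (le_lt_trans (probability_le1 _ _)) ?ltry //; exact: setup_measurable_init.
have mX k : measurable_fun setT (X k) by exact: setup_measurable_payoff.
have sK := swapK cb' cb; pose f i a := (swap b' b (i, a)).2.
rewrite [LHS](_ : _ = mrestr P (setup_measurable_init a)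
  [set w | forall k l, beaten b' k l -> X (swap b' b k) w < X (swap b' b l) w]).
  apply: (@order_event_same_law _ T R K (mrestr P (setup_measurable_init a))
    (mrestr P (setup_measurable_init a')) (fun k => X (swap b' b k)) X) => // B mB.
  transitivity (mrestr P (setup_measurable_init a)
      [set w | forall k, B (swap b' b k) (X k w)]).
    congr (P (_ `&` _)); apply/seteqP; split=> w /= h k; last by have := h (swap b' b k); rewrite sK.
    by have := h (swap b' b k); rewrite sK.
  transitivity ((#|{: profile m}|%:R^-1)%:E * \big[*%E/1%E]_(i < n)
      \big[*%E/1%E]_(c : profile m) P (U i c @^-1` B (swap b' b (i, c))))%E.
    exact: (@setup_rectangle a (fun k => B (swap b' b k))).
  rewrite [RHS](@setup_rectangle a' B mB); congr mule; apply: eq_bigr => i _.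
  (* For each player the swap permutes the profiles, and identical distribution matches the
     factors. *)
  rewrite [RHS](reindex_inj (h := f i)); last first.
    apply: inv_inj => c; rewrite /f.
    by have := congr1 snd (sK (i, c)).
  by apply: eq_bigr => c _; case: setup => _ _ _ ident _; exact: ident.
congr (P (_ `&` _)); apply/seteqP; split=> w /= h k l kl.
  by apply: (h (swap b' b k) (swap b' b l)); rewrite beaten_swap.
rewrite -[k]sK -[l]sK; apply: h.
by rewrite -(beaten_swap _ _ cb' cb) !sK.
Qed.

Lemma payoff_tie_null i a c : a != c -> P [set w | U i a w = U i c w] = 0%E.
Proof.
move=> ac; case: (setup) => _ _ ind _ atomless.
apply: independent_tie_null => //; try exact: setup_measurable_payoff.
move=> A B mA mB.
(* A rectangle constraining only two coordinates, which extracts their pairwise independence. *)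
pose C (k : K) : set R := if k == (i, a) then A else if k == (i, c) then B else setT.
have mC k : measurable (C k) by rewrite /C; do 2?case: ifP => // _; exact: measurableT.
have Cc : C (i, c) = B by rewrite /C eq_sym xpair_eqE (negbTE ac) andbF eqxx.
have := ind (fun j e => C (j, e)) setT (fun j e => mC _).
rewrite preimage_setT probability_setT mul1e pair_bigA /=.
rewrite (bigD1 (i, a)) //= (bigD1 (i, c)) /=; last by rewrite xpair_eqE eq_sym (negbTE ac) andbF.
rewrite big1 => [|[j e] /= /andP[ja jc]]; last first.
  by rewrite /C (negbTE ja) (negbTE jc) preimage_setT probability_setT.
rewrite mule1 Cc [C (i, a)]/C eqxx => <-; congr (P _); apply/seteqP; split=> w /=.
  move=> [Aw Bw]; split=> // j e; rewrite /C; case: eqP => [[-> ->]//|_].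
  by case: eqP => [[-> ->]|].
move=> [_ h]; split; first by have := h i a; rewrite /C eqxx.
by have := h i c; rewrite Cc.
Qed.

(** Off the finitely many null tie events a consistent strict table exists, and together with [A0]
    it names a cell containing the outcome. *)
Lemma cell_cover_ae : P (~` \bigcup_w cell w) = 0%E.
Proof.
apply: measure_negligible.
  by apply: measurableC; apply: fin_bigcup_measurable => [|w _]; [exact: finite_finset|exact: measurable_cell].
pose tie (p : 'I_n * (profile m * profile m)) := [set w | U p.1 p.2.1 w = U p.1 p.2.2 w].
apply: (@negligibleS _ _ _ _ (\big[setU/set0]_(p | p.2.1 != p.2.2) tie p)).
  move=> w /= nw; apply: contrapT => nt; apply: nw.
  have [|b [cb hb]] := @strict_table_exists n m R (fun i a => U i a w).
    move=> i a c ac; apply/eqP => e; apply: nt.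
    by rewrite (bigD1 (i, (a, c))) //; left.
  by exists (A0 w, b) => //; rewrite /cell /= cb.
elim/big_ind: _ => [|A B|[i [a c]] /= ac]; [exact: negligible_set0|exact: negligibleU|].
exists (tie (i, (a, c))); split=> //; last exact: payoff_tie_null.
by apply: measurable_eqr; exact: setup_measurable_payoff.
Qed.

Lemma prob_cells (A : set T) : measurable A ->
  P A = (\sum_(w in states m) P (A `&` cell w))%E.
Proof.
move=> mA; rewrite [LHS](measure_ae_partition measurable_cell trivIset_cell cell_cover_ae mA).
rewrite [RHS]big_mkcond; apply: eq_bigr => w _; rewrite inE.
by case: ifP => // cw; rewrite /cell cw setI0 measure0.
Qed.

Lemma prob_cell w : consistent w.2 -> P (cell w) = (#|states m|%:R^-1)%:E.
Proof.
move=> cw; have := probability_setT P; rewrite (prob_cells measurableT).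
rewrite (eq_bigr (fun=> P (cell w))) => [|v]; last first.
  by rewrite inE setTI => cv; exact: cell_equiprobable.
have : P (cell w) \is a fin_num by apply: fin_num_measure; exact: measurable_cell.
move=> /fineK <-; set p := fine _; rewrite sumEFin sumr_const => -[e].
have {}e : #|states m|%:R * p = 1 by rewrite mulr_natl.
have nz : #|states m|%:R != 0 :> R.
  by apply/eqP => e0; move: e; rewrite e0 mul0r => /esym/eqP; rewrite oner_eq0.
by congr EFin; apply: (mulfI nz); rewrite e divff.
Qed.

Lemma states_gt0 : (0 < #|states m|)%N.
Proof.
rewrite lt0n; apply/negP => /eqP e0.
have := probability_setT P; rewrite (prob_cells measurableT).
rewrite big_pred0 => [/esym/eqP|w]; first by rewrite eqe oner_eq0.
by rewrite (cards0_eq e0) finset.in_set0.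
Qed.

(** The event is a finite union of fibres of the pair formed by the initial profile and the record
    of all payoff comparisons. *)
Lemma measurable_hit_by t : measurable (hit_by U A0 t).
Proof.
pose cmp w : {ffun K * K -> bool} := [ffun p => X p.1 w <= X p.2 w].
pose F (z : profile m * {ffun K * K -> bool}) := A0 @^-1` [set z.1] `&` [set w | forall p, cmp w p = z.2 p].
have mF z : measurable (F z).
  apply: measurableI; first exact: setup_measurable_init.
  apply: measurable_forall => p.
  have -> : (fun w => cmp w p = z.2 p) =
      if z.2 p then [set w | X p.1 w <= X p.2 w] else ~` [set w | X p.1 w <= X p.2 w].
    apply/seteqP; split=> w; rewrite /cmp ffunE; case: (z.2 p) => //= /negP.
      by [].
    by move=> /negbTE.
  by case: ifP => _; [|apply: measurableC]; apply: measurable_ler; exact: setup_measurable_payoff.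
rewrite (_ : hit_by U A0 t = \bigcup_(z in [set (A0 w, cmp w) | w in hit_by U A0 t]) F z).
  by apply: fin_bigcup_measurable => [|z _]; [exact: finite_finset|exact: mF].
apply/seteqP; split=> w.
  by move=> hw; exists (A0 w, cmp w) => //; exists w.
move=> [_ [v hv <-] [/= eA ec]]; case: hv => s [st pv]; exists s; split=> //.
have eb := @eq_best_response n m R (fun i a => U i a w) (fun i a => U i a v).
move=> i; rewrite eA (eq_clockwork (eb _)) ?eb ?pv // => j a c.
all: by have := ec ((j, a), (j, c)); rewrite !ffunE.
Qed.

(** On a cell the dynamic is the play of its table, so the event contains the cell or misses it. *)
Lemma prob_hit_by t :
  P (hit_by U A0 t) = (#|hit_states m t|%:R / #|states m|%:R)%:E.
Proof.
rewrite (prob_cells (measurable_hit_by t)).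
rewrite (eq_bigr (fun w => if w \in hit_states m t then (#|states m|%:R^-1)%:E else 0%E)).
  rewrite -big_mkcondr /= sumEFin sumr_const mulrC mulr_natr; congr EFin; congr (_ *+ _).
  apply: eq_card => w; rewrite -[LHS]/((w \in states m) && (w \in hit_states m t)).
  by rewrite [w \in hit_states _ _]inE; case: (w \in states m).
move=> w; rewrite inE => cw.
have bE v : cell w v -> (forall i a, best_response (fun i a => U i a v) i a = w.2 i a) /\ A0 v = w.1.
  by rewrite /cell cw => -[/(strict_table_best_response cw)].
case: hit_statesP => h.
  rewrite -(prob_cell cw); congr (P _); apply/seteqP; split=> v; first by case.
  move=> cv; split=> //; have [e eA] := bE _ cv; case: h => _ [s s0 ps].
  exists s; split=> // i; rewrite (clockwork_play e) e eA.
  exact: (table_PNEP _ _ ps).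
rewrite (_ : _ `&` _ = set0) ?measure0 //; apply/seteqP; split=> // v [[s [s0 ps]] cv].
apply: h; split=> //; exists s => //; have [e eA] := bE _ cv.
by apply/table_PNEP => i; have := ps i; rewrite (clockwork_play e) e eA.
Qed.

End Setup.

(** * From counts to the real bounds *)

Lemma prod_others_mul n (m : 'I_n -> nat) i :
  (m i * prod_others m i)%N = (\prod_(j < n) m j)%N.
Proof.
rewrite (bigD1 i) //=; congr (_ * _)%N; rewrite /prod_others; apply: eq_bigl => j.
by rewrite !inE.
Qed.

(** A player with the most actions has the fewest environments, and dividing by the maximum removes
    its factor. *)
Lemma q_nm_prod_others (R : realType) n (m : 'I_n -> nat) :
  (0 < n)%N -> (forall i, 0 < m i)%N ->
  exists2 i0, q_nm R m = (prod_others m i0)%:R &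
    (0 < prod_others m i0)%N /\ forall i, (prod_others m i0 <= prod_others m i)%N.
Proof.
move=> n0 m0; have [i0 e] : {i0 | \max_(i < n) m i = m i0}%N by apply: bigop.eq_bigmax; rewrite card_ord.
have pos : (0 < prod_others m i0)%N by rewrite prodn_gt0.
exists i0; first rewrite /q_nm e -natr_prod -(prod_others_mul m i0) natrM mulrC mulKf //.
  by rewrite pnatr_eq0 -lt0n.
split=> // i; rewrite -(leq_pmul2l (m0 i0)) prod_others_mul -(prod_others_mul m i).
by rewrite leq_mul2r -e bigop.leq_bigmax orbT.
Qed.

Theorem lemma2 (d : measure_display) (T : measurableType d) (R : realType)
  (P : probability T R) (n : nat) (m : 'I_n -> nat)
  (U : 'I_n -> profile m -> T -> R) (A0 : T -> profile m) (t : nat) :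
  (2 <= n)%N -> (forall i, 2 <= m i)%N ->
  random_game_setup P U A0 ->
  let q : R := q_nm R m in
  let lower : R := (t %/ n)%:R * q^-1 *
     (1 - ((t + n.-1) %/ n)%:R ^+ 2 / 2 * (n%:R / q)) in
  ((lower%:E <= P (hit_by U A0 t)) /\ (P (hit_by U A0 t) <= (t%:R / q)%:E))%E.
Proof.
move=> n2 m2 setup q lower; have n0 : (0 < n)%N by exact: ltnW.
have [i0 qE [pos minq]] := q_nm_prod_others R n0 (fun i => ltnW (m2 i)).
rewrite (prob_hit_by setup) !lee_fin /lower /q qE.
have S0 := states_gt0 setup.
have up := card_hit_states_le n0 t minq; have low := card_hit_states_ge n0 t minq.
move: pos S0 up low; move: (prod_others m i0) #|states m| #|hit_states m t| => p S H.
rewrite -(ltr_nat R) -(ltr_nat R 0 S) => p0 S0.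
rewrite -(ler_nat R) !natrM => up; rewrite -(ler_nat R) natrD !(natrX, natrM) => low.
split; last by rewrite ler_pdivrMr // mulrAC ler_pdivlMr.
set k : R := (t %/ n)%:R in low *; set c : R := (_ %/ n)%:R.
have k0 : 0 <= k by rewrite ler0n.
(* [c] is the ceiling of t/n; the count gives the stronger bound with the floor [k] in its place. *)
have kc : k <= c by rewrite ler_nat leq_div2r // leq_addr.
have kc2 : k ^+ 2 <= c ^+ 2 by rewrite lerXn2r ?nnegrE // ler0n.
apply: (@le_trans _ _ (k * p%:R^-1 * (1 - k ^+ 2 / 2 * (n%:R / p%:R)))).
  rewrite ler_wpM2l ?divr_ge0 ?(ltW p0) // lerD2l lerN2 ler_wpM2r ?divr_ge0 ?ler0n //.
  by rewrite ler_wpM2r // invr_ge0.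
(* Multiplying by [2 * p%:R ^+ 2] recovers the integer inequality [low]. *)
rewrite ler_pdivlMr // -(ler_pM2l (x := 2 * p%:R ^+ 2)); last by rewrite mulr_gt0 ?exprn_gt0.
have -> : 2 * p%:R ^+ 2 * (k / p%:R * (1 - k ^+ 2 / 2 * (n%:R / p%:R)) * S%:R) =
    2 * k * p%:R * S%:R - S%:R * (n%:R * k ^+ 3) :> R.
  by field; rewrite (gt_eqF p0).
by rewrite lerBlDr.
Qed.
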